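(* For every integer $n\ge 0$, let $P_3(n)$ denote the number of partitions of $n$ into distinct parts, each congruent to one of $-2^3,-2^2,-2^1,-2^0 \pmod{15}$. Let $G_3(n)$ denote the number of partitions of $n$ into parts $\not\equiv 2^3,2^2,2^1,2^0\pmod{15}$ that satisfy all of the following conditions: (i) the difference between parts $\not\equiv 0\pmod{15}$ is $\ge 15$, with equality only if a part is $\equiv -2^3,-2^2,-2^1,-2^0\pmod{15}$; (ii) parts which are $\not\equiv -2^3,-2^2,-2^1,-2^0\pmod{15}$ are $>15$; (iii) the difference between the multiples of $15$ occurring as parts is $\ge 60$; (iv) the smallest multiple of $15$ occurring as a part (if there is one) is $$\begin{cases}\ge 30+30\tau, & \text{if } 7 \text{ is a part},\\ \ge 45+30\tau, & \text{otherwise},\end{cases}$$ where $\tau$ is the number of parts of the partition that are not multiples of $15$. Then $G_3(n)=P_3(n)$.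
   Context: In (i) and (iii), ''the difference between the parts'' refers to the difference (larger minus smaller) between any two parts of the indicated kind in the partition, where a repeated part counts as two parts with difference $0$ (so repetitions are excluded by (i) and (iii)). The congruence ''$\equiv -2^3,-2^2,-2^1,-2^0\pmod{15}$'' means congruent to one of these four residues, and ''$\not\equiv 2^3,2^2,2^1,2^0 \pmod{15}$'' means not congruent to any of them. *)

(* Defs.v *)
From HB Require Import structures.
From mathcomp Require Import all_boot.

Set Implicit Arguments.
Unset Strict Implicit.
Unset Printing Implicit Defensive.

Definition is_partition (n : nat) (s : seq nat) : bool :=
  [&& sorted geq s, 0 \notin s & sumn s == n].

Record intpart (n : nat) : Type :=
  IntPart { parts :> seq nat; _ : is_partition n parts }.

HB.instance Definition _ n := [isSub for @parts n].
HB.instance Definition _ n := [Countable of intpart n by <:].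

Lemma leq_part n (p : intpart n) x : x \in parts p -> x <= n.
Proof.
case: p => s /= /and3P[_ _ /eqP <-] xs.
by rewrite (perm_sumn (perm_to_rem xs)) /= leq_addr.
Qed.

Lemma size_parts n (p : intpart n) : size p <= n.
Proof.
case: p => s /= /and3P[_ s0 /eqP <-].
elim: s s0 => //= x s IHs; rewrite in_cons negb_or => /andP[x0 /IHs les].
by rewrite -add1n leq_add // lt0n eq_sym.
Qed.

Lemma intpart_codeP n (p : intpart n) : size (map (@inord n) p) <= n.
Proof. by rewrite size_map size_parts. Qed.

Definition intpart_code n (p : intpart n) : n.-bseq 'I_n.+1 :=
  Bseq (intpart_codeP p).

Definition intpart_decode n (c : n.-bseq 'I_n.+1) : option (intpart n) :=
  insub (map (@nat_of_ord _) c).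

Lemma intpart_codeK n : pcancel (@intpart_code n) (@intpart_decode n).
Proof.
move=> p; rewrite /intpart_decode /= -map_comp map_id_in ?valK // => x xp /=.
rewrite inordK // ltnS; exact: leq_part xp.
Qed.

HB.instance Definition _ n : isFinite (intpart n) :=
  PCanIsFinite (@intpart_codeK n).

Definition pow2_mod15 (x : nat) : bool :=
  has (fun j => x == 2 ^ j %[mod 15]) (iota 0 4).

(* x = - 2 ^ j modulo 15, written without subtraction. *)
Definition negpow2_mod15 (x : nat) : bool :=
  has (fun j => x + 2 ^ j == 0 %[mod 15]) (iota 0 4).

Definition P3 (n : nat) : nat :=
  #|[set p : intpart n | uniq p && all negpow2_mod15 p]|.

Definition mult15 (s : seq nat) : seq nat := [seq x <- s | 15 %| x].
Definition nonmult15 (s : seq nat) : seq nat := [seq x <- s | ~~ (15 %| x)].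

(* The parts are listed in nonincreasing order, so pairwise compares x >= y and
   the truncated subtraction x - y is the difference of the two parts. *)
Definition nonmult15_gaps (s : seq nat) : bool :=
  pairwise (fun x y => (15 <= x - y) &&
              ((x - y == 15) ==> negpow2_mod15 x || negpow2_mod15 y))
           (nonmult15 s).

Definition non_negpow2_gt15 (s : seq nat) : bool :=
  all (fun x => ~~ negpow2_mod15 x ==> (15 < x)) s.

Definition mult15_gaps (s : seq nat) : bool :=
  pairwise (fun x y => 60 <= x - y) (mult15 s).

Definition least_mult15_bound (s : seq nat) : bool :=
  let tau := size (nonmult15 s) in
  let bound := if 7 \in s then 30 + 30 * tau else 45 + 30 * tau in
  all (fun x => all (leq x) (mult15 s) ==> (bound <= x)) (mult15 s).

Definition G3 (n : nat) : nat :=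
  #|[set p : intpart n |
      [&& all (fun x => ~~ pow2_mod15 x) p,
          nonmult15_gaps p, non_negpow2_gt15 p, mult15_gaps p
        & least_mult15_bound p]]|.

(* Main.v *)
(* Proof idea. In a partition counted by G3, list the parts that are not
   multiples of 15 increasingly and subtract 15 * i from the i-th one, i = 0, 1, ..;
   if there are tau of them, subtract 15 * (2 * tau + 1 + 4 * i) from the i-th
   multiple of 15. The gap conditions disappear, and if m is the number of parts,
   multiples of 15 counted twice, then 15 * binom(m, 2) was subtracted in total.
   Hence, with q = x^15, the generating function of G3 is E(V(Z)), where E is the
   linear map Z^m |-> q^binom(m, 2) and V is a product of geometric-type series in Z
   times a polynomial, symmetric in the parameters a = x^7, b = x^11, c = x^13,
   d = x^14. Since E(Z f(Z)) = E(f(qZ)), and V_a - (1 + a) V_(aq) has the form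
   Z g(Z) - g(qZ), we get E(V_a) = (1 + a) E(V_(aq)); iterating replaces a by 0 and
   produces prod_k (1 + a q^k). Doing the same with b, c and d leaves E(1) = 1.
   All series are truncated modulo x^(n+1), where every product is finite. *)

From HB Require Import structures.
Require Import Defs.
From mathcomp Require Import all_boot all_order all_algebra.
From mathcomp Require Import ring zify.

Set Implicit Arguments.
Unset Strict Implicit.
Unset Printing Implicit Defensive.

Import GRing.Theory.

(** * Lists with prescribed multiplicities *)

(** An explicit enumeration rather than a predicate: one independent choice of multiplicity per part
    size makes sums over it factor, as in [mult_lists_gf]. *)
Fixpoint mult_lists (ms : nat -> seq nat) v : seq (seq nat) :=
  if v is v'.+1 then [seq nseq i v ++ l | i <- ms v, l <- mult_lists ms v']
  else [:: [::]].

Lemma geq_trans : transitive geq.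
Proof. by move=> y x z /= xy yz; apply: leq_trans yz xy. Qed.

Lemma sorted_geq_split v l : sorted geq l -> all (fun u => 0 < u <= v.+1) l ->
  l = nseq (count_mem v.+1 l) v.+1 ++ [seq u <- l | u <= v].
Proof.
elim: l => //= x l IHl xl /andP[/andP[x0 xv] lv].
have [-> | xv'] := eqVneq x v.+1.
  rewrite ltnn ?eqxx -[nat_of_bool true]/1 add1n /=; congr (_ :: _).
  by apply: IHl => //; exact: path_sorted xl.
have xlev: x <= v by lia.
have lt_l : all (fun u => u <= v) l.
  apply: sub_all (order_path_min geq_trans xl) => u /= ux; exact: leq_trans xlev.
rewrite xlev (all_filterP lt_l) (count_memPn _) //.
by apply/negP => /(allP lt_l); rewrite ltnn.
Qed.

Lemma mem_mult_lists ms v l : (l \in mult_lists ms v) =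
  [&& sorted geq l, all (fun u => 0 < u <= v) l
    & all (fun u => count_mem u l \in ms u) (iota 1 v)].
Proof.
elim: v l => [|v IHv] l.
  rewrite /= andbT inE; case: l => //= x l; rewrite andbC.
  by case: x.
rewrite -[v.+1]addn1 iotaD all_cat /= andbT [1 + v]addnC addn1.
apply/allpairsP/idP => [[[i l'] /= [ims]] | /and3P[sl al /andP[cl cv]]].
  rewrite IHv => /and3P[sl al cl] ->.
  have nv : count_mem v.+1 l' = 0.
    by apply/count_memPn/negP => /(allP al); rewrite ltnn andbF.
  rewrite all_cat all_nseq count_cat count_nseq /= eqxx mul1n nv addn0 ims.
  rewrite ltnS leqnn orbT /= andbT; apply/and3P; split.
  - rewrite sorted_pairwise; last exact: geq_trans.
    rewrite pairwise_cat -!(sorted_pairwise geq_trans) sl andbT.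
    apply/andP; split.
      apply/allrelP => x y /nseqP[-> _] /(allP al)/andP[_ yv] /=; exact: leqW.
    by elim: i {ims} => //= -[|i] IHi //=; rewrite leqnn.
  - by apply: sub_all al => u /andP[-> /leqW].
  apply/allP => u ul; have := allP cl u ul; rewrite mem_iota in ul.
  rewrite count_cat count_nseq /= (_ : (v.+1 == u) = false) ?mul0n //; lia.
exists (count_mem v.+1 l, [seq u <- l | u <= v]); split=> //=; last first.
  exact: sorted_geq_split.
rewrite IHv (sorted_filter geq_trans) // /=; apply/andP; split.
  apply/allP => u; rewrite mem_filter => /andP[uv /(allP al)]; lia.
apply/allP => u ul; have := allP cl u ul; rewrite mem_iota in ul.
rewrite count_filter (@eq_count _ (predI _ _) (pred1 u)) // => w /=.
by case: eqP => //= ->; lia.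
Qed.

Lemma mult_lists_uniq ms v : (forall u, uniq (ms u)) -> uniq (mult_lists ms v).
Proof.
move=> ums; elim: v => //= v IHv; apply: allpairs_uniq => //.
have notin l : l \in mult_lists ms v -> count_mem v.+1 l = 0.
  rewrite mem_mult_lists => /and3P[_ al _].
  by apply/count_memPn/negP => /(allP al); rewrite ltnn andbF.
move=> [i l] [j m] /allpairsP[[? ?] /= [_ /notin il [-> ->]]].
move=> /allpairsP[[? ?] /= [_ /notin jm [-> ->]]] /= eq_ij.
have := congr1 (count_mem v.+1) eq_ij.
rewrite !count_cat !count_nseq /= eqxx !mul1n il jm !addn0 => eij.
by move/eqP: eq_ij; rewrite eij eqseq_cat ?eqxx // => /eqP ->.
Qed.

Lemma mult_lists_gf (R : comNzRingType) (w : nat -> R) ms v :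
  (\sum_(l <- mult_lists ms v) \prod_(u <- l) w u
   = \prod_(1 <= u < v.+1) \sum_(i <- ms u) w u ^+ i)%R.
Proof.
elim: v => [|v IHv] /=; first by rewrite big_seq1 big_nil big_geq.
rewrite big_nat_recr //= -IHv mulrC big_distrl big_allpairs_dep /=.
apply: eq_bigr => i _; rewrite big_distrr; apply: eq_bigr => l _ /=.
by rewrite big_cat big_nseq iter_mulr_1.
Qed.

(** [E] may contain sequences of every sum, so a generating function can be taken over all of [E]
    before one coefficient is selected. *)
Lemma card_intpart n (E : seq (seq nat)) (Q : pred (seq nat)) :
  uniq E -> {in E, forall s, sorted geq s && (0 \notin s)} ->
  (forall s, is_partition n s -> Q s = (s \in E)) ->
  #|[set p : intpart n | Q p]| = count (fun s => sumn s == n) E.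
Proof.
move=> uE sE QE; rewrite cardE -(size_map (@parts n)) -size_filter.
apply/perm_size/uniq_perm.
- by rewrite map_inj_uniq ?enum_uniq //; exact: val_inj.
- exact: filter_uniq.
move=> s; rewrite mem_filter; apply/mapP/andP => [[p]|[sn sinE]].
  rewrite mem_enum inE => Qp ->; have := valP p => /= pp.
  by rewrite -QE //; case/and3P: pp.
have ps : is_partition n s.
  by rewrite /is_partition sn; have /andP[-> ->] := sE s sinE.
by exists (IntPart ps) => //; rewrite mem_enum inE QE.
Qed.

(** * Removing the staircases *)

(** For a nonincreasing list, [size l'] is the rank of a part counted from the smallest. The
    smallest part receives 15 * h, and each earlier one 15 * g more than its successor. *)
Fixpoint stair g h (l : seq nat) : seq nat :=
  if l is x :: l' then x + 15 * (h + g * size l') :: stair g h l' else [::].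

Fixpoint unstair g h (l : seq nat) : seq nat :=
  if l is x :: l' then x - 15 * (h + g * size l') :: unstair g h l' else [::].

Lemma size_stair g h l : size (stair g h l) = size l.
Proof. by elim: l => //= x l ->. Qed.

Lemma size_unstair g h l : size (unstair g h l) = size l.
Proof. by elim: l => //= x l ->. Qed.

Lemma stairK g h : cancel (stair g h) (unstair g h).
Proof. by elim=> //= x l ->; rewrite ?size_stair addnK. Qed.

Lemma sumn_stair g h l :
  sumn (stair g h l) = sumn l + 15 * (h * size l + g * 'C(size l, 2)).
Proof.
elim: l => [|x l /= ->]; first by rewrite /= bin0n !muln0.
by rewrite ?binS ?bin1; lia.
Qed.

Lemma all_stair (P : pred nat) g h l :
  (forall x k, P (x + 15 * k) = P x) -> all P (stair g h l) = all P l.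
Proof. by move=> per; elim: l => //= x l ->; rewrite per. Qed.

(** Neighbours have ranks [k.+1] and [k], so a gap relation on the staircase turns into a relation
    free of [k]. Pairwise conditions are first reduced to neighbours by transitivity. *)
Lemma sorted_stair (r r' : rel nat) g h l :
  (forall x y k, r (x + 15 * (h + g * k.+1)) (y + 15 * (h + g * k)) = r' x y) ->
  sorted r (stair g h l) = sorted r' l.
Proof. by move=> rr'; elim: l => //= x [|y l] //= <-; rewrite rr'. Qed.

(** Adding up the gaps from the smallest part, which exceeds 15 * h, shows that the truncated
    subtractions of [unstair] are genuine and leave positive parts. *)
Lemma unstair_head g h x l : path (fun x y => 15 * g + y <= x) x l ->
  all (ltn (15 * h)) (x :: l) -> 15 * (h + g * size l) < x.
Proof.
elim: l x => [|y l IHl] x /=; first by rewrite andbT muln0 addn0.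
by move=> /andP[xy /IHl{}IHl] /andP[_ /IHl]; lia.
Qed.

Lemma unstairK g h l : sorted (fun x y => 15 * g + y <= x) l ->
  all (ltn (15 * h)) l -> stair g h (unstair g h l) = l /\ 0 \notin unstair g h l.
Proof.
elim: l => //= x l IHl pl /[dup] al /andP[_ al'].
have [eq_l l0] := IHl (path_sorted pl) al'.
have := unstair_head pl al; rewrite inE negb_or l0 => lt_x; split; last lia.
rewrite eq_l size_unstair subnK //; exact: ltnW.
Qed.

(** The bound is decided by the smallest entry, which is shifted by exactly 15 * h. *)
Lemma all_leq_stair b g h l : sorted geq l ->
  all (leq (b + 15 * h)) (stair g h l) = all (leq b) l.
Proof.
elim: l => //= x l IHl pl; rewrite IHl ?(path_sorted pl) //.
case: l {IHl} pl => [|y l] /=; first by lia.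
by case/andP=> xy _; case: (leqP b y) => by_; rewrite ?andbF //=; congr (_ && _); lia.
Qed.

Lemma least_bound_sorted b l : sorted geq l ->
  all (fun x => all (leq x) l ==> (b <= x)) l = all (leq b) l.
Proof.
move=> sl; apply/idP/idP => [|/allP al]; last first.
  by apply/allP => x /al bx; apply/implyP.
case/lastP: l sl => // l z; rewrite (sorted_pairwise geq_trans) pairwise_rcons.
case/andP=> lz _; rewrite !all_rcons leqnn lz /= => /andP[bz _]; rewrite bz.
by apply: sub_all lz => x /=; apply: leq_trans.
Qed.

(** The steps 1 and 4 are the gaps 15 and 60 divided by 15. The offset is chosen so that 30 + 30 *
    tau = 15 + 15 * (2 * tau + 1), which makes the bounds in (iv) independent of tau. *)
Definition stack (c : seq nat) : seq nat :=
  sort geq (stair 1 0 (nonmult15 c)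
            ++ stair 4 (2 * size (nonmult15 c) + 1) (mult15 c)).

Lemma dvdn15_shift x k : (15 %| x + 15 * k) = (15 %| x).
Proof. by rewrite mulnC dvdn_addl ?dvdn_mull. Qed.

Lemma pow2_mod15_shift x k : pow2_mod15 (x + 15 * k) = pow2_mod15 x.
Proof. by rewrite /pow2_mod15 /= [x + _]addnC [15 * k]mulnC !modnMDl. Qed.

Lemma negpow2_mod15_shift x k : negpow2_mod15 (x + 15 * k) = negpow2_mod15 x.
Proof.
by rewrite /negpow2_mod15 /= [x + _]addnC [15 * k]mulnC -!addnA !modnMDl.
Qed.

Lemma geq_total : total geq.
Proof. by move=> x y; exact: leq_total. Qed.

Lemma sorted_geq_stair g h l : sorted geq l -> sorted geq (stair g h l).
Proof.
elim: l => //= x [|y l] //= IHl /andP[xy /IHl ->]; rewrite andbT; lia.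
Qed.

Lemma filter_true (T : Type) (P : pred T) l : all P l -> filter P l = l.
Proof. by move/all_filterP. Qed.

Lemma filter_none (T : eqType) (P : pred T) (l : seq T) :
  all (predC P) l -> filter P l = [::].
Proof. by rewrite all_predC has_filter negbK => /eqP. Qed.

Lemma nonmult15_sort l m : sorted geq l ->
  all (fun x => ~~ (15 %| x)) l -> all (dvdn 15) m ->
  nonmult15 (sort geq (l ++ m)) = l /\ (sorted geq m -> mult15 (sort geq (l ++ m)) = m).
Proof.
move=> sl nl dm; rewrite /nonmult15 /mult15.
rewrite !(filter_sort geq_total geq_trans) !filter_cat.
rewrite (filter_true nl) (filter_none (l := m)); last first.
  by apply: sub_all dm => x /= ->.
rewrite (filter_none (l := l)) // (filter_true dm) cats0 /=.
by split=> [|sm]; apply: (sorted_sort geq_trans).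
Qed.

Lemma nonmult15_stack c : sorted geq c -> nonmult15 (stack c) = stair 1 0 (nonmult15 c).
Proof.
move=> sc; apply: (proj1 (nonmult15_sort _ _ _)).
- by rewrite sorted_geq_stair // (sorted_filter geq_trans).
- by rewrite all_stair ?filter_all // => x k; rewrite dvdn15_shift.
- by rewrite all_stair ?filter_all // => x k; rewrite dvdn15_shift.
Qed.

Lemma mult15_stack c : sorted geq c ->
  mult15 (stack c) = stair 4 (2 * size (nonmult15 c) + 1) (mult15 c).
Proof.
move=> sc; apply: (proj2 (nonmult15_sort _ _ _)).
- by rewrite sorted_geq_stair // (sorted_filter geq_trans).
- by rewrite all_stair ?filter_all // => x k; rewrite dvdn15_shift.
- by rewrite all_stair ?filter_all // => x k; rewrite dvdn15_shift.
- by rewrite sorted_geq_stair // (sorted_filter geq_trans).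
Qed.

Lemma perm_nonmult15_mult15 c : perm_eq (nonmult15 c ++ mult15 c) c.
Proof. by rewrite perm_catC perm_filterC. Qed.

Lemma sorted_geq_eq c c' : sorted geq c -> sorted geq c' ->
  nonmult15 c = nonmult15 c' -> mult15 c = mult15 c' -> c = c'.
Proof.
move=> sc sc' en em; apply: (sorted_eq geq_trans _ sc sc').
  by move=> x y /andP[yx xy]; apply/eqP; rewrite eqn_leq; apply/andP.
by rewrite -(permPl (perm_nonmult15_mult15 c)) en em perm_nonmult15_mult15.
Qed.

Lemma stack_inj c c' : sorted geq c -> sorted geq c' -> stack c = stack c' -> c = c'.
Proof.
move=> sc sc' ecc'.
have en : nonmult15 c = nonmult15 c'.
  by apply: (can_inj (stairK 1 0)); rewrite -!nonmult15_stack ?ecc'.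
apply: sorted_geq_eq => //; apply: (can_inj (stairK 4 (2 * size (nonmult15 c) + 1))).
by rewrite -mult15_stack // en -mult15_stack ?ecc'.
Qed.

Lemma all_stack (P : pred nat) c : (forall x k, P (x + 15 * k) = P x) ->
  all P (stack c) = all P c.
Proof.
move=> per; rewrite all_sort all_cat !all_stair // -all_cat.
exact/perm_all/perm_nonmult15_mult15.
Qed.

Definition weight15 x := if 15 %| x then 2 else 1.

Lemma sumn_weight15 c :
  sumn (map weight15 c) = size (nonmult15 c) + 2 * size (mult15 c).
Proof.
elim: c => //= x c ->; rewrite /weight15; case: (15 %| x) => /=; lia.
Qed.

(** The three terms on the right are the staircase of the m parts, the offsets of the k multiples of
    15 and their steps of 4. Giving multiples of 15 weight 2 merges them into one binomial
    coefficient. *)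
Lemma bin2_double_size m k :
  'C(m + 2 * k, 2) = 'C(m, 2) + (2 * m + 1) * k + 4 * 'C(k, 2).
Proof.
elim: k => [|k IHk]; first by rewrite bin0n !muln0 !addn0.
by rewrite (_ : m + 2 * k.+1 = (m + 2 * k).+2) ?binS ?bin1 ?bin0 ?IHk; lia.
Qed.

Lemma sumn_stack c : sumn (stack c) = sumn c + 15 * 'C(sumn (map weight15 c), 2).
Proof.
rewrite (perm_sumn (permEl (perm_sort _ _))) sumn_cat !sumn_stair.
rewrite sumn_weight15 bin2_double_size -(perm_sumn (perm_nonmult15_mult15 c)) sumn_cat.
lia.
Qed.

(** Condition (i) without the staircase: a difference of 15 has become an equality. A part is called
    secondary if it is neither a multiple of 15 nor congruent to some -2^j. *)
Definition no_repeated_secondary (l : seq nat) : bool :=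
  sorted (fun x y => (y <= x) && ((x == y) ==> negpow2_mod15 x)) l.

(* Always applied to [last 16 l]: the default 16 makes it hold for empty [l]. *)
Definition neg_or_large x := negpow2_mod15 x || (15 < x).

Lemma nonmult15_gaps_stack c : sorted geq c ->
  nonmult15_gaps (stack c) = no_repeated_secondary (nonmult15 c).
Proof.
(* The gap relation is transitive because two gaps of at least 15 add up to more than 15, so
   neighbouring parts suffice. *)
move=> sc; rewrite /nonmult15_gaps nonmult15_stack // -sorted_pairwise; last first.
  by move=> y x z /=; lia.
apply: sorted_stair => x y k; rewrite !add0n !mul1n !negpow2_mod15_shift.
have -> : x + 15 * k.+1 - (y + 15 * k) = x + 15 - y by lia.
have [yx|xy] := leqP y x; last by apply/negbTE; lia.
have -> : (15 <= x + 15 - y) by lia.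
have -> : (x + 15 - y == 15) = (x == y) by lia.
by case: eqP => //= ->; rewrite orbb.
Qed.

Lemma mult15_gaps_stack c : sorted geq c -> mult15_gaps (stack c).
Proof.
move=> sc; rewrite /mult15_gaps mult15_stack // -sorted_pairwise; last first.
  by move=> y x z /=; lia.
rewrite (@sorted_stair _ geq) ?(sorted_filter geq_trans) // => x y k /=.
by apply/idP/idP; lia.
Qed.

Lemma mem_le_last (l : seq nat) x : sorted geq l -> x \in l -> last 16 l <= x.
Proof.
case/lastP: l => // l z; rewrite (sorted_pairwise geq_trans) pairwise_rcons last_rcons.
by case/andP=> /allP lz _; rewrite mem_rcons inE => /predU1P[->|/lz].
Qed.

(** Every entry but the last is a positive number shifted by at least 15, so only the last one can
    violate (ii). *)
Lemma non_negpow2_gt15_stair l : 0 \notin l ->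
  all (fun x => ~~ negpow2_mod15 x ==> (15 < x)) (stair 1 0 l) = neg_or_large (last 16 l).
Proof.
rewrite /neg_or_large; elim: l => //= x [|y l] IHl.
  by rewrite /= ?muln0 ?addn0 andbT implyNb.
rewrite inE negb_or => /andP[x0 /IHl ->] /=.
suff -> : 15 < x + 15 * (0 + 1 * (size l).+1) by rewrite implybT.
lia.
Qed.

Lemma non_negpow2_gt15_stack c : sorted geq c -> 0 \notin c ->
  non_negpow2_gt15 (stack c) = neg_or_large (last 16 (nonmult15 c)).
Proof.
move=> sc c0; rewrite /non_negpow2_gt15 /stack all_sort all_cat.
rewrite non_negpow2_gt15_stair; last first.
  by rewrite mem_filter (negbTE c0) andbF.
rewrite andbC (_ : all _ _) //.
(* The offset alone puts the multiples of 15 above 15, so they satisfy (ii). *)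
apply: (@sub_all _ (leq (1 + 15 * (2 * size (nonmult15 c) + 1)))).
  by move=> x ?; apply/implyP; lia.
rewrite all_leq_stair ?(sorted_filter geq_trans) //.
by apply/allP => x; rewrite mem_filter => /andP[_]; case: x => //; rewrite (negbTE c0).
Qed.

(** Since 7 < 15, it can only be the unshifted last entry. *)
Lemma mem7_stair l : 0 \notin l -> (7 \in stair 1 0 l) = (last 16 l == 7).
Proof.
elim: l => // x [|y l] IHl.
  by rewrite /= !inE ?muln0 ?addn0 eq_sym.
rewrite inE negb_or => /andP[x0 l0].
by rewrite -[stair _ _ _]/(_ :: stair 1 0 (y :: l)) inE IHl //=; lia.
Qed.

Definition G3_cond (s : seq nat) : bool :=
  [&& all (fun x => ~~ pow2_mod15 x) s, nonmult15_gaps s, non_negpow2_gt15 s,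
      mult15_gaps s & least_mult15_bound s].

(** The trace of [G3_cond] on the reduced list. Condition (iii) has vanished, and (iv) bounds the
    multiples of 15 by 15 or 30, which only restricts the part 15. *)
Definition config (c : seq nat) : bool :=
  [&& all (fun x => ~~ pow2_mod15 x) c, no_repeated_secondary (nonmult15 c),
      neg_or_large (last 16 (nonmult15 c)) & (15 \in c) ==> (7 \in c)].

Lemma mem_last16 (l : seq nat) x : last 16 l = x -> x != 16 -> x \in l.
Proof. by move=> <- /negPf; have := mem_last 16 l; rewrite inE => /predU1P[->|]. Qed.

(** 7 is the least natural number congruent to some -2^j, so an admissible smallest part that is at
    most 7 equals 7. *)
Lemma mem7_last (l : seq nat) : sorted geq l -> neg_or_large (last 16 l) ->
  (last 16 l == 7) = (7 \in l).
Proof.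
move=> sl nl; apply/eqP/idP => [/mem_last16 -> //|/(mem_le_last sl)].
by case: (last 16 l) nl; do 8!case=> //.
Qed.

Lemma least_mult15_bound_stack c : sorted geq c -> 0 \notin c ->
  neg_or_large (last 16 (nonmult15 c)) ->
  least_mult15_bound (stack c) = ((15 \in c) ==> (7 \in c)).
Proof.
move=> sc c0 nl; have sm := sorted_filter geq_trans (dvdn 15) sc.
have sn := sorted_filter geq_trans (fun x => ~~ (15 %| x)) sc.
rewrite /least_mult15_bound.
rewrite (_ : (7 \in stack c) = (7 \in nonmult15 (stack c))); last by rewrite mem_filter.
rewrite nonmult15_stack // mult15_stack // size_stair least_bound_sorted; last first.
  exact: sorted_geq_stair.
rewrite mem7_stair ?mem_filter ?(negbTE c0) ?andbF // mem7_last //.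
rewrite (_ : (7 \in nonmult15 c) = (7 \in c)); last by rewrite mem_filter.
(* Splitting off the offset 15 * (2 * t + 1) leaves the bound 15 or 30. *)
set t := size _; have -> : (if 7 \in c then 30 + 30 * t else 45 + 30 * t)
    = (if 7 \in c then 15 else 30) + 15 * (2 * t + 1) by case: ifP; lia.
rewrite all_leq_stair //.
have c15 x : x \in mult15 c -> exists2 k, x = k.+1 * 15 & x \in c.
  rewrite mem_filter => /andP[/dvdnP[[|k] ->]] xc; last by exists k.
  by rewrite xc in c0.
case: ifP => _; rewrite ?implybT.
  by apply/allP => x /c15[k -> _]; lia.
rewrite implybF; apply/allP/idP => [al|n15 x /c15[[|k] ->]].
- by apply/negP => c15'; have := al 15; rewrite mem_filter c15' => /(_ isT).
- by rewrite (negbTE n15).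
- by move=> _; lia.
Qed.

Lemma G3_cond_stack c : sorted geq c -> 0 \notin c -> G3_cond (stack c) = config c.
Proof.
move=> sc c0; rewrite /G3_cond /config all_stack; last first.
  by move=> x k; rewrite pow2_mod15_shift.
rewrite nonmult15_gaps_stack // non_negpow2_gt15_stack // mult15_gaps_stack //=.
case: (boolP (neg_or_large _)) => [nl|]; last by rewrite !andbF.
by rewrite least_mult15_bound_stack.
Qed.

(** The preimage is found by subtracting both staircases: the gap conditions keep each list
    nonincreasing, and positivity of the reduced multiples of 15 comes from (iv). *)
Lemma stack_surj s : sorted geq s -> 0 \notin s -> G3_cond s ->
  exists c, [/\ sorted geq c, 0 \notin c & stack c = s].
Proof.
move=> ss s0 /and5P[_ gn _ gm lb].
have sm := sorted_filter geq_trans (dvdn 15) ss.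
have sn := sorted_filter geq_trans (fun x => ~~ (15 %| x)) ss.
pose tau := size (nonmult15 s).
have [||eq_n n0] := @unstairK 1 0 (nonmult15 s).
- apply: sub_sorted (pairwise_sorted gn) => x y /= /andP[xy _]; lia.
- by apply/allP => x; rewrite mem_filter => /andP[_]; case: x => //; rewrite (negbTE s0).
have [||eq_m m0] := @unstairK 4 (2 * tau + 1) (mult15 s).
- apply: sub_sorted (pairwise_sorted gm) => x y /= xy; lia.
(* Both bounds in (iv) exceed the offset 15 * (2 * tau + 1). *)
- move: lb; rewrite /least_mult15_bound least_bound_sorted //.
  by apply: sub_all => x /=; rewrite -/tau; case: ifP => _; lia.
set n := unstair 1 0 _ in eq_n n0; set m := unstair 4 _ _ in eq_m m0.
have sorted_n : sorted geq n.
  have := pairwise_sorted gn; rewrite -eq_n.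
  suff /sub_sorted h : subrel (fun x y => (15 <= x - y)
      && ((x - y == 15) ==> negpow2_mod15 x || negpow2_mod15 y))
      (fun x y => 15 + y <= x).
    by move/h; rewrite (@sorted_stair _ geq) // => x y k; apply/idP/idP => /=; lia.
  by move=> x y /andP[]; lia.
have sorted_m : sorted geq m.
  have := pairwise_sorted gm; rewrite -eq_m (@sorted_stair _ geq) // => x y k /=.
  by apply/idP/idP; lia.
have all_n : all (fun x => ~~ (15 %| x)) n.
  by rewrite -(@all_stair _ 1 0) ?eq_n ?filter_all // => x k; rewrite dvdn15_shift.
have all_m : all (dvdn 15) m.
  rewrite -(@all_stair _ 4 (2 * tau + 1)) ?eq_m ?filter_all // => x k.
  by rewrite dvdn15_shift.
have [nE mE] := nonmult15_sort sorted_n all_n all_m.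
exists (sort geq (n ++ m)); split.
- exact: sort_sorted geq_total _.
- by rewrite mem_sort mem_cat negb_or n0.
have size_n : size n = tau by rewrite -(size_stair 1 0) eq_n.
rewrite /stack nE mE // size_n eq_n eq_m.
apply: (sorted_eq geq_trans) => //; last first.
  by rewrite perm_sort perm_nonmult15_mult15.
- exact: sort_sorted geq_total _.
- by move=> x y /andP[yx xy]; apply/eqP; rewrite eqn_leq; apply/andP.
Qed.

(** * Enumerating the configurations *)

(* In a configuration the smallest part that is not a multiple of 15
   must not be one of the small secondary parts 3, 5, 6, 9, 10, 12, and 15 may
   occur only together with 7. Whether 7 and 11 occur decides which of these parts
   are excluded, so each of the three cases below is a condition on the
   multiplicity of each part separately. *)
Definition mult_large N u : seq nat :=
  if (15 %| u) || negpow2_mod15 u then iota 0 N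
  else if pow2_mod15 u then [:: 0] else [:: 0; 1].

Definition mult_no7_no11 N u : seq nat :=
  if 15 < u then mult_large N u
  else if u \in [:: 13; 14] then iota 0 N else [:: 0].

Definition mult_no7_11 N u : seq nat :=
  if 15 < u then mult_large N u
  else if u == 11 then iota 1 N.-1
  else if u == 12 then [:: 0; 1]
  else if u \in [:: 13; 14] then iota 0 N else [:: 0].

Definition mult_7 N u : seq nat :=
  if 15 < u then mult_large N u
  else if u == 7 then iota 1 N.-1
  else if u \in [:: 9; 10; 12] then [:: 0; 1]
  else if u \in [:: 11; 13; 14; 15] then iota 0 N else [:: 0].

(** Three disjoint cases: neither 7 nor 11, 11 without 7, and 7. The caps [N] on multiplicities and
    [v] on parts keep the lists finite; [config_confs] shows that no configuration of sum below [N]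
    is lost when N <= v + 1. *)
Definition confs N v : seq (seq nat) :=
  mult_lists (mult_no7_no11 N) v ++ mult_lists (mult_no7_11 N) v
  ++ mult_lists (mult_7 N) v.

Lemma mod15_ind (P : pred nat) : (forall x k, P (x + 15 * k) = P x) ->
  all P (iota 0 15) -> forall x, P x.
Proof.
move=> per /allP P15 x; rewrite (divn_eq x 15) addnC mulnC per.
by apply: P15; rewrite mem_iota ltn_mod.
Qed.

Lemma pow2_mod15N u : (15 %| u) || negpow2_mod15 u -> ~~ pow2_mod15 u.
Proof.
apply/implyP; move: u; apply: mod15_ind => // x k.
by rewrite dvdn15_shift negpow2_mod15_shift pow2_mod15_shift.
Qed.

Lemma no_repeated_secondary_count l : sorted geq l ->
  no_repeated_secondary l = all (fun u => negpow2_mod15 u || (count_mem u l <= 1)) l.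
Proof.
have tr : transitive (fun x y => (y <= x) && ((x == y) ==> negpow2_mod15 x)).
  move=> y x z /= /andP[yx xy] /andP[zy _]; rewrite (leq_trans zy yx) /=.
  apply/implyP => /eqP xz; move: xy; rewrite (_ : x == y) //.
  by rewrite eqn_leq yx xz zy.
move=> sl; rewrite /no_repeated_secondary (sorted_pairwise tr).
move: sl; rewrite (sorted_pairwise geq_trans).
elim: l => //= x l IHl /andP[xl /IHl ->]; rewrite eqxx add1n ltnS leqn0.
have -> : all (fun y => (y <= x) && ((x == y) ==> negpow2_mod15 x)) l
          = negpow2_mod15 x || (count_mem x l == 0).
  case: (boolP (negpow2_mod15 x)) => nx /=.
    by apply: sub_all xl => y /= ->; rewrite implybT.
  rewrite -[_ == 0]negbK -lt0n -has_count -all_predC; apply: eq_in_all => y yl.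
  by rewrite /= implybF eq_sym; have /= -> := allP xl y yl.
case: (boolP (_ || _)) => //= nx; apply: eq_in_all => y yl.
have [xy|] := eqVneq x y; last by rewrite add0n.
case/orP: nx => [|/eqP x0]; first by rewrite xy => ->.
by move: yl; rewrite -xy -has_pred1 has_count x0.
Qed.

(** With 1, 2, 4, 8 excluded, a smallest nonmultiple of 15 that is below 15 must be 7, 11, 13 or 14.
    So 3, 5, 6 never occur, 9 and 10 need a 7 below them, and 12 needs a 7 or an 11. *)
Definition low_config (c : seq nat) : bool :=
  [&& 3 \notin c, 5 \notin c, 6 \notin c, (9 \in c) ==> (7 \in c),
      (10 \in c) ==> (7 \in c) & (12 \in c) ==> ((7 \in c) || (11 \in c))].

Lemma neg_or_large_last c : sorted geq c -> 0 \notin c ->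
  all (fun x => ~~ pow2_mod15 x) c ->
  neg_or_large (last 16 (nonmult15 c)) = low_config c.
Proof.
move=> sc c0 np.
pose m x := x \in nonmult15 c.
have me x : ~~ (15 %| x) -> (x \in c) = m x by rewrite /m mem_filter => ->.
rewrite /low_config !me //.
have le_last x : m x -> last 16 (nonmult15 c) <= x.
  by apply: mem_le_last; apply: (sorted_filter geq_trans).
have last_in : last 16 (nonmult15 c) != 16 -> m (last 16 (nonmult15 c)).
  exact: mem_last16.
have mP x : m x -> (0 < x) && ~~ pow2_mod15 x && ~~ (15 %| x).
  rewrite /m mem_filter => /andP[-> xc]; rewrite (allP np x xc) !andbT.
  by case: x xc => //; rewrite (negbTE c0).
have nle x : m x = (last 16 (nonmult15 c) <= x) && m x.
  by rewrite andbC; case: (boolP (m x)) => //= /le_last ->.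
move: (last 16 _) last_in nle {le_last} => z zin nle.
(* Each membership now carries the test z <= x, so the value of the smallest part z decides the
   claim. The case z > 15 includes the default 16 of an empty list. *)
rewrite (nle 3) (nle 5) (nle 6) (nle 7) (nle 9) (nle 10) (nle 11) (nle 12).
have [z16|z16] := ltnP 15 z.
  rewrite /neg_or_large z16 orbT; do 8?[rewrite (ltn_geF (leq_trans _ z16)) //].
have {}zin : m z by apply: zin; rewrite neq_ltn ltnS z16.
move/mP: (zin); move: zin z16 {mP nle}.
do 16?[case: z => [|z]; first try by []]; try by [].
all: by move=> zin _ _; rewrite zin /= ?implybT.
Qed.

Lemma configE c : sorted geq c -> 0 \notin c ->
  config c = [&& all (fun x => ~~ pow2_mod15 x) c,
    all (fun u => [|| 15 %| u, negpow2_mod15 u | count_mem u c <= 1]) c,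
    low_config c & (15 \in c) ==> (7 \in c)].
Proof.
move=> sc c0; rewrite /config; case: (boolP (all _ c)) => //= np.
rewrite neg_or_large_last //; congr (_ && _).
rewrite no_repeated_secondary_count ?(sorted_filter geq_trans) // all_filter.
apply: eq_all => u /=; case: (boolP (15 %| u)) => //= nu.
congr (_ || (_ <= 1)); rewrite count_filter; apply: eq_count => x /=.
by case: eqP => //= ->.
Qed.

Lemma mem_mult_lists_low N ms v c : 15 <= v ->
  (forall u, 15 < u -> ms u = mult_large N u) ->
  (c \in mult_lists ms v) =
  [&& sorted geq c, all (fun u => 0 < u <= v) c,
      all (fun u => count_mem u c \in mult_large N u) (iota 16 (v - 15))
    & all (fun u => count_mem u c \in ms u) (iota 1 15)].
Proof.
move=> v15 msE; rewrite mem_mult_lists -{2}(subnKC v15) iotaD all_cat.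
congr [&& _, _ & _]; rewrite andbC; congr (_ && _).
by apply: eq_in_all => u; rewrite mem_iota => /andP[u16 _]; rewrite msE.
Qed.

Lemma mem_confs N v c : 15 <= v -> (c \in confs N v) =
  [&& sorted geq c, all (fun u => 0 < u <= v) c,
      all (fun u => count_mem u c \in mult_large N u) (iota 16 (v - 15))
    & [|| all (fun u => count_mem u c \in mult_no7_no11 N u) (iota 1 15),
          all (fun u => count_mem u c \in mult_no7_11 N u) (iota 1 15)
        | all (fun u => count_mem u c \in mult_7 N u) (iota 1 15)]].
Proof.
move=> v15; rewrite /confs !mem_cat !(@mem_mult_lists_low N) //;
  try by move=> u u15; rewrite /mult_no7_no11 /mult_no7_11 /mult_7 u15.
by case: (sorted _ _) => //=; case: (all _ c) => //=; case: (all _ _).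
Qed.

Lemma confs_uniq N v : 15 <= v -> uniq (confs N v).
Proof.
move=> v15; have lg u : uniq (mult_large N u).
  by rewrite /mult_large; do ?case: ifP => // _; rewrite iota_uniq.
have u1 : uniq (mult_lists (mult_no7_no11 N) v).
  apply: mult_lists_uniq => u; rewrite /mult_no7_no11.
  by do ?case: ifP => _ //; rewrite ?lg ?iota_uniq.
have u2 : uniq (mult_lists (mult_no7_11 N) v).
  apply: mult_lists_uniq => u; rewrite /mult_no7_11.
  by do ?case: ifP => _ //; rewrite ?lg ?iota_uniq.
have u3 : uniq (mult_lists (mult_7 N) v).
  apply: mult_lists_uniq => u; rewrite /mult_7.
  by do ?case: ifP => _ //; rewrite ?lg ?iota_uniq.
have cnt ms u c : c \in mult_lists ms v -> 0 < u <= 15 -> count_mem u c \in ms u.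
  rewrite mem_mult_lists => /and3P[_ _ /allP al] u15; apply: al.
  by rewrite mem_iota; lia.
(* The three lists are told apart by the multiplicities of 7 and 11. *)
rewrite /confs cat_uniq u1 cat_uniq u2 u3 /= andbT; apply/andP; split.
  apply/hasPn => c; rewrite mem_cat => /orP[] cin; apply/negP => /cnt h.
    have := cnt _ 11 _ cin isT; have := h 11 isT.
    by rewrite !inE /= mem_iota => /eqP ->.
  have := cnt _ 7 _ cin isT; have := h 7 isT.
  by rewrite !inE /= mem_iota => /eqP ->.
apply/hasPn => c /cnt cin; apply/negP => /cnt h.
have := cin 7 isT; have := h 7 isT.
by rewrite !inE /= mem_iota => /eqP ->.
Qed.

Lemma confs_config N v c : 15 <= v -> c \in confs N v ->
  [/\ sorted geq c, 0 \notin c & config c].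
Proof.
move=> v15; rewrite mem_confs // => /and4P[sc al /allP hi lo].
have c0 : 0 \notin c by apply/negP => /(allP al).
split=> //; rewrite configE // /low_config -!has_pred1 !has_count -!leqNgt !leqn0.
have cpos u : u \in c -> 0 < count_mem u c by rewrite -has_pred1 has_count.
have ok u : u \in c -> ~~ pow2_mod15 u &&
    [|| 15 %| u, negpow2_mod15 u | count_mem u c <= 1].
  move=> uc; have := cpos _ uc; have := allP al _ uc => /andP[u0 uv].
  have [u16|u15] := ltnP 15 u.
    have /hi : u \in iota 16 (v - 15) by rewrite mem_iota; lia.
    rewrite /mult_large.
    have := @pow2_mod15N u.
    case: (15 %| u) => /= [/(_ isT) -> //|].
    case: (negpow2_mod15 u) => /= [/(_ isT) -> //|_].
    case: (pow2_mod15 u); rewrite !inE; lia.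
  have {lo}: (count_mem u c \in mult_no7_no11 N u)
      || (count_mem u c \in mult_no7_11 N u) || (count_mem u c \in mult_7 N u).
    have uin : u \in iota 1 15 by rewrite mem_iota; lia.
    by case/or3P: lo => /allP/(_ u uin) ->; rewrite ?orbT.
  move: (count_mem u c) => k; move: u0 u15 {uc uv}.
  do 16?[case: u => [|u]; first try by []]; try by [];
    move=> _ _; rewrite /mult_no7_no11 /mult_no7_11 /mult_7 /= !inE ?mem_iota; lia.
apply/and3P; split.
- by apply/allP => u /ok/andP[].
- by apply/allP => u /ok/andP[].
case/or3P: lo; rewrite /= /mult_no7_no11 /mult_no7_11 /mult_7 /= !inE ?mem_iota; lia.
Qed.

Lemma count_mem_sumn u c : 0 \notin c -> count_mem u c <= sumn c.
Proof.
elim: c => //= x c IHc; rewrite inE negb_or => /andP[x0 /IHc].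
by case: eqP; lia.
Qed.

Lemma config_confs N v c : 15 <= v -> N <= v.+1 -> sumn c < N ->
  sorted geq c -> 0 \notin c -> config c -> c \in confs N v.
Proof.
move=> v15 Nv cN sc c0; rewrite configE // => /and4P[/allP np /allP ns lc c15].
rewrite mem_confs // sc /=.
have cnt u : count_mem u c < N by apply: leq_ltn_trans (count_mem_sumn u c0) cN.
have le_sumn u : u \in c -> u <= sumn c.
  by move=> uc; rewrite (perm_sumn (perm_to_rem uc)) /= leq_addr.
have p2 u : pow2_mod15 u -> count_mem u c = 0.
  by move=> pu; apply/count_memPn/negP => /np; rewrite pu.
have sec u : [|| 15 %| u, negpow2_mod15 u | count_mem u c <= 1].
  have [/ns //|] := boolP (u \in c).
  by move/count_memPn ->; rewrite !orbT.
apply/and3P; split.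
- apply/allP => u uc; have := le_sumn u uc.
  have : u != 0 by apply: contraNneq c0 => <-.
  lia.
- apply/allP => u _; rewrite /mult_large; have := sec u; rewrite orbA.
  case: ifP => _ /=; first by rewrite mem_iota cnt.
  by case: ifP => [/p2 -> //|_]; rewrite !inE; lia.
rewrite /low_config -!has_pred1 !has_count -!leqNgt !leqn0 in lc.
rewrite -!has_pred1 !has_count in c15.
move: lc c15.
have := p2 1 isT; have := p2 2 isT; have := p2 4 isT; have := p2 8 isT.
have /= := sec 9; have /= := sec 10; have /= := sec 12.
have := cnt 7; have := cnt 11; have := cnt 13; have := cnt 14; have := cnt 15.
rewrite /= /mult_no7_no11 /mult_no7_11 /mult_7 /= !inE ?mem_iota.
set k7 := count_mem 7 c; set k11 := count_mem 11 c.
(* The presence of 7 and 11 selects the list; with a 7 present, the third list covers both cases for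
   11. *)
have [k7_0|k7_gt0] := posnP k7; have [k11_0|k11_gt0] := posnP k11.
- rewrite /= ?orbF ?orbT ?implybF ?implybT ?andbT => *; apply/or3P/Or31; lia.
- rewrite /= ?orbF ?orbT ?implybF ?implybT ?andbT => *; apply/or3P/Or32; lia.
- rewrite /= ?orbF ?orbT ?implybF ?implybT ?andbT => *; apply/or3P/Or33; lia.
- rewrite /= ?orbF ?orbT ?implybF ?implybT ?andbT => *; apply/or3P/Or33; lia.
Qed.

(** * Both partition counts over explicit enumerations *)

Local Open Scope ring_scope.

Lemma all_leq_stair_ge b g h l : all (leq b) l -> all (leq b) (stair g h l).
Proof. by elim: l => //= x l IHl /andP[bx /IHl ->]; rewrite (leq_trans bx) ?leq_addr. Qed.

Lemma stack_gt0 c : 0%N \notin c -> 0%N \notin stack c.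
Proof.
move=> c0; have pos (P : pred nat) : all (leq 1) [seq x <- c | P x].
  apply/allP => x; rewrite mem_filter => /andP[_].
  by case: x => //; rewrite (negbTE c0).
suff /allP s1 : all (leq 1) (stack c) by apply/negP => /s1.
by rewrite all_sort all_cat !all_leq_stair_ge // pos.
Qed.

Lemma G3_count n v : (15 <= v)%N -> (n <= v)%N ->
  G3 n = count (fun s => sumn s == n) (map stack (confs n.+1 v)).
Proof.
move=> v15 nv; apply: (@card_intpart n _ G3_cond).
- rewrite map_inj_in_uniq ?confs_uniq // => c c' /confs_config[] // sc _ _.
  by move=> /confs_config[] // sc' _ _; apply: stack_inj.
- move=> _ /mapP[c /confs_config[] // sc c0 _ ->].
  by rewrite stack_gt0 // andbT; apply: sort_sorted geq_total _.
move=> s /and3P[ss s0 /eqP sn]; apply/idP/mapP => [Gs|[c /confs_config[] // sc c0 cc ->]].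
  have [c [sc c0 es]] := stack_surj ss s0 Gs; exists c => //.
  apply: config_confs => //; last by rewrite -G3_cond_stack // es.
  (* Stacking only adds to the sum, so a preimage of a partition of n has sum at most n. *)
  by rewrite ltnS -sn -es sumn_stack leq_addr.
by rewrite G3_cond_stack.
Qed.

Definition mult_P3 u : seq nat := if negpow2_mod15 u then [:: 0; 1]%N else [:: 0%N].

Lemma P3_count n v : (n <= v)%N ->
  P3 n = count (fun s => sumn s == n) (mult_lists mult_P3 v).
Proof.
move=> nv; apply: (@card_intpart n _ (fun s => uniq s && all negpow2_mod15 s)).
- by apply: mult_lists_uniq => u; rewrite /mult_P3; case: ifP.
- move=> s; rewrite mem_mult_lists => /and3P[-> al _] /=.
  by apply/negP => /(allP al).
move=> s /and3P[ss s0 /eqP sn]; rewrite mem_mult_lists ss /=.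
have al : all (fun u => 0 < u <= v)%N s.
  apply/allP => u us; have : (u <= sumn s)%N.
    by rewrite (perm_sumn (perm_to_rem us)) /= leq_addr.
  by rewrite sn => /leq_trans -> //; rewrite andbT lt0n; apply: contraNneq s0 => <-.
rewrite al /=; apply/andP/allP => [[us /allP ns] u _|cs].
  rewrite /mult_P3 (count_uniq_mem u us).
  by case: (boolP (u \in s)) => [/ns ->|_] //; case: ifP.
have us u : u \in s -> count_mem u s \in mult_P3 u.
  by move=> us; apply: cs; have := allP al u us; rewrite mem_iota; lia.
split; last first.
  apply/allP => u /[dup] /us; rewrite /mult_P3; case: ifP => // _.
  by rewrite inE -has_pred1 has_count => /eqP ->.
apply: count_mem_uniq => u; case: (boolP (u \in s)) => [/[dup] u_s /us|/count_memPn //].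
move: u_s; rewrite -has_pred1 has_count /mult_P3.
by case: ifP => _; rewrite !inE => /[swap]; [case/orP|] => /eqP ->.
Qed.

(** The blocks run from 15 * k + 1 to 15 * k + 15, so the first one holds exactly the parts up to
    15, where the multiplicity rules are exceptional. *)
Lemma prod_by15 (R : comNzRingType) (F : nat -> R) N :
  \prod_(1 <= u < (15 * N).+1) F u
  = \prod_(k < N) \prod_(r < 15) F (15 * k + r.+1)%N.
Proof.
elim: N => [|N IHN]; first by rewrite muln0 big_geq // big_ord0.
rewrite big_ord_recr /= -IHN (big_cat_nat (n := (15 * N).+1)) //=; last first.
  by rewrite ltnS leq_mul2l leqnSn.
congr (_ * _); rewrite -{1}[(15 * N).+1]add0n big_addn.
rewrite (_ : ((15 * N.+1).+1 - (15 * N).+1 = 15)%N); last by lia.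
by rewrite big_mkord; apply: eq_bigr => r _; congr F; lia.
Qed.

(** * The functional equation *)

(* Here pa = bcd/q, pb = acd/q, pc = abd/q, pd = abc/q and xi = abcd/q^2. They are
   independent arguments because q is nilpotent in the ring of the application. *)
Definition numer (S : comNzRingType) (q a b c d pa pb pc pd xi z : S) : S :=
  1 + (pa + pb + pc + pd - xi) * z ^+ 2 + xi * (a + b + c + d - q) * z ^+ 3
    + xi ^+ 2 * q * z ^+ 5.
Definition certif (S : comNzRingType) (a b c d pa pb pc pd xi z : S) : S :=
  a + (pb + pc + pd) * z + xi * (b + c + d) * z ^+ 2 + xi * pa * z ^+ 3.
Definition pairs_prod (S : comNzRingType) (a b c d z : S) : S :=
  (1 + a * b * z) * (1 + a * c * z) * (1 + a * d * z)
  * ((1 + b * c * z) * (1 + b * d * z) * (1 + c * d * z)).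

(* Multiplied by the product M of [energy_step], this says that
   V_a - (1 + a) V_(aq) = Z g(Z) - g(qZ). The polynomial [certif] was found by
   solving for its coefficients. *)
Definition telescopes (S : comNzRingType) (q a b c d pa pb pc pd xi z : S) :=
  pairs_prod a b c d z * numer q a b c d pa pb pc pd xi z
  - (1 + a) * ((1 - a * z) * (1 - xi * z ^+ 2)
     * ((1 + b * c * z) * (1 + b * d * z) * (1 + c * d * z)))
     * numer q (a * q) b c d pa (pb * q) (pc * q) (pd * q) (xi * q) z
  = z * certif a b c d pa pb pc pd xi z * pairs_prod a b c d z
    - certif a b c d pa pb pc pd xi (q * z)
      * ((1 - a * z) * (1 - b * z) * (1 - c * z) * (1 - d * z)
         * ((1 - xi * z ^+ 2) * (1 - xi * q * z ^+ 2))).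

(** Division by q expresses pa, pb, pc, pd and xi through the other parameters, leaving a rational
    identity. *)
Lemma telescopes_field (K : fieldType) (q a b c d pa pb pc pd xi z : K) :
  q != 0 -> q * pa = b * c * d -> q * pb = a * c * d -> q * pc = a * b * d ->
  q * pd = a * b * c -> q * xi = a * pa ->
  telescopes q a b c d pa pb pc pd xi z.
Proof.
move=> q0 ea eb ec ed exi.
have div x y : q * x = y -> x = y / q by move<-; rewrite mulrC mulKf.
rewrite (div _ _ exi) (div _ _ ea) (div _ _ eb) (div _ _ ec) (div _ _ ed).
by rewrite /telescopes /numer /certif /pairs_prod; field.
Qed.

Lemma telescopes_rmorph (S T : comNzRingType) (f : {rmorphism S -> T})
    (q a b c d pa pb pc pd xi z : S) :
  telescopes q a b c d pa pb pc pd xi z ->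
  telescopes (f q) (f a) (f b) (f c) (f d) (f pa) (f pb) (f pc) (f pd) (f xi) (f z).
Proof.
move/(congr1 f); rewrite /telescopes /numer /certif /pairs_prod.
by rewrite !(rmorphB, rmorphD, rmorphM, rmorphXn, rmorph1).
Qed.

(** In the fraction field q is invertible, and the identity has no denominators, so it descends to
    [S]. [telescopes_rmorph] then carries it to rings where q is nilpotent. *)
Lemma telescopes_idomain (S : idomainType) (q a b c d pa pb pc pd xi z : S) :
  q != 0 -> q * pa = b * c * d -> q * pb = a * c * d -> q * pc = a * b * d ->
  q * pd = a * b * c -> q * xi = a * pa ->
  telescopes q a b c d pa pb pc pd xi z.
Proof.
move=> q0 ea eb ec ed exi.
pose f := @tofrac S.
have: telescopes (f q) (f a) (f b) (f c) (f d) (f pa) (f pb) (f pc) (f pd) (f xi) (f z).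
  by apply: telescopes_field; rewrite /f ?tofrac_eq0 -?rmorphM ?ea ?eb ?ec ?ed ?exi.
rewrite /telescopes /numer /certif /pairs_prod -(tofrac1 S) /f.
rewrite -!(tofracN, tofracD, tofracM, tofracXn).
by move/eqP; rewrite tofrac_eq => /eqP.
Qed.

(** * The map E and truncated q-products *)

Section Series.
Variables (R : comNzRingType) (q : R).

Definition energy (f : {poly R}) : R := \sum_(i < size f) f`_i * q ^+ 'C(i, 2).

Lemma energyE n (f : {poly R}) :
  (size f <= n)%N -> energy f = \sum_(i < n) f`_i * q ^+ 'C(i, 2).
Proof.
move=> le_fn; rewrite /energy (big_ord_widen _ (fun i => f`_i * q ^+ 'C(i, 2)) le_fn).
rewrite big_mkcond /=; apply: eq_bigr => i _.
by case: ltnP => // /(nth_default 0) ->; rewrite mul0r.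
Qed.

Lemma energyD f g : energy (f + g) = energy f + energy g.
Proof.
set n := maxn (size f) (size g).
rewrite (energyE (n := n)) ?size_polyD // !(@energyE n) ?leq_maxl ?leq_maxr //.
by rewrite -big_split; apply: eq_bigr => i _; rewrite coefD mulrDl.
Qed.

Lemma energyZ k f : energy (k *: f) = k * energy f.
Proof.
rewrite (@energyE (size f)) ?size_scale_leq // mulr_sumr.
by apply: eq_bigr => i _; rewrite coefZ mulrA.
Qed.

Lemma energyB f g : energy (f - g) = energy f - energy g.
Proof. by rewrite energyD -scaleN1r energyZ mulN1r. Qed.

Lemma energy_sum I (r : seq I) (P : pred I) (F : I -> {poly R}) :
  energy (\sum_(i <- r | P i) F i) = \sum_(i <- r | P i) energy (F i).
Proof.
apply: (big_morph energy energyD).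
by rewrite /energy size_poly0 big_ord0.
Qed.

Lemma energyXn n : energy 'X^n = q ^+ 'C(n, 2).
Proof.
rewrite /energy size_polyXn big_ord_recr /= coefXn eqxx mul1r big1 ?add0r // => i _.
by rewrite coefXn ltn_eqF ?mul0r.
Qed.

Definition dilate (f : {poly R}) : {poly R} := f \Po (q *: 'X).

Lemma coef_dilate f i : (dilate f)`_i = f`_i * q ^+ i.
Proof.
rewrite /dilate comp_polyE coef_sum.
under eq_bigr => j _ do rewrite exprZn !coefZ coefXn.
have [lt_if | le_fi] := ltnP i (size f).
  rewrite (bigD1 (Ordinal lt_if)) //= eqxx mulr1 big1 ?addr0 // => j.
  by rewrite -val_eqE /= eq_sym => /negPf ->; rewrite !mulr0.
rewrite nth_default // mul0r big1 // => j _.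
by rewrite gtn_eqF ?mulr0 // (leq_trans (ltn_ord j)).
Qed.

(** This is binom(i + 1, 2) = binom(i, 2) + i read on coefficients. *)
Lemma energyXM f : energy ('X * f) = energy (dilate f).
Proof.
rewrite (@energyE (size f).+1); last first.
  by rewrite mulrC (leq_trans (size_polyMleq _ _)) // size_polyX addn2.
rewrite (@energyE (size f)); last first.
  by apply/leq_sizeP => j le_fj; rewrite coef_dilate nth_default ?mul0r.
rewrite big_ord_recl /= coefXM mul0r add0r; apply: eq_bigr => i _.
by rewrite coefXM /= coef_dilate /bump /= add1n binS bin1 exprD mulrA mulrAC.
Qed.

Variable N : nat.
Hypothesis q_nil : q ^+ N = 0.

(** With [multi_gf] and [multi2_gf], truncations of the infinite products of 1 + x q^k Z, 1 / (1 - x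
    q^k Z) and 1 / (1 - x q^k Z^2). As q^N = 0, the factors with k >= N are 1. *)
Definition distinct_gf (x : R) : {poly R} := \prod_(k < N) (1 + (x * q ^+ k) *: 'X).
Definition geo (p : {poly R}) : {poly R} := \sum_(i < N) p ^+ i.
Definition multi_gf (x : R) : {poly R} := \prod_(k < N) geo ((x * q ^+ k) *: 'X).
Definition multi2_gf (x : R) : {poly R} := \prod_(k < N) geo ((x * q ^+ k) *: 'X^2).

Lemma geo_inv p : p ^+ N = 0 -> (1 - p) * geo p = 1.
Proof. by move=> p0; rewrite -opprB mulNr -subrX1 p0 sub0r opprK. Qed.

Lemma geo0 : (0 < N)%N -> geo 0 = 1.
Proof.
rewrite /geo; case: (N) => // n _.
by rewrite big_ord_recl expr0 big1 ?addr0 // => i _; rewrite exprS mul0r.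
Qed.

Lemma N_gt0 : (0 < N)%N.
Proof. by move: q_nil; case: (N) => // /eqP; rewrite expr0 oner_eq0. Qed.

(** Shifting the index drops the first factor and brings in [F N], which is 1; so truncated products
    shift like infinite ones. *)
Lemma prod_shift (F : nat -> {poly R}) : F N = 1 ->
  \prod_(k < N) F k = F 0%N * \prod_(k < N) F k.+1.
Proof.
move=> FN; transitivity (\prod_(k < N.+1) F k); last by rewrite big_ord_recl.
by rewrite big_ord_recr /= FN mulr1.
Qed.

Lemma distinct_gf_shift x : distinct_gf x = (1 + x *: 'X) * distinct_gf (x * q).
Proof.
rewrite /distinct_gf (prod_shift (F := fun k => 1 + (x * q ^+ k) *: 'X)).
  by rewrite expr0 mulr1; congr (_ * _); apply: eq_bigr => k _; rewrite exprS mulrA.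
by rewrite q_nil mulr0 scale0r addr0.
Qed.

Lemma multi_gf_shift x : x ^+ N = 0 -> (1 - x *: 'X) * multi_gf x = multi_gf (x * q).
Proof.
move=> x0; rewrite /multi_gf (prod_shift (F := fun k => geo ((x * q ^+ k) *: 'X))).
  rewrite expr0 mulr1 mulrA geo_inv ?mul1r ?exprZn ?x0 ?scale0r //.
  by apply: eq_bigr => k _; rewrite exprS mulrA.
by rewrite q_nil mulr0 scale0r geo0 ?N_gt0.
Qed.

Lemma multi2_gf_shift x : x ^+ N = 0 -> (1 - x *: 'X^2) * multi2_gf x = multi2_gf (x * q).
Proof.
move=> x0; rewrite /multi2_gf (prod_shift (F := fun k => geo ((x * q ^+ k) *: 'X^2))).
  rewrite expr0 mulr1 mulrA geo_inv ?mul1r ?exprZn ?x0 ?scale0r //.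
  by apply: eq_bigr => k _; rewrite exprS mulrA.
by rewrite q_nil mulr0 scale0r geo0 ?N_gt0.
Qed.

Lemma dilateM f g : dilate (f * g) = dilate f * dilate g.
Proof. exact: rmorphM. Qed.

Lemma dilateZX k : dilate (k *: 'X) = (k * q) *: 'X.
Proof. by rewrite /dilate comp_polyZ comp_polyX scalerA. Qed.

Lemma dilateZX2 k : dilate (k *: 'X^2) = (k * q ^+ 2) *: 'X^2.
Proof. by rewrite /dilate comp_polyZ rmorphXn /= comp_polyX exprZn scalerA. Qed.

Lemma dilate_geo p : dilate (geo p) = geo (dilate p).
Proof.
rewrite /dilate /geo raddf_sum /=; apply: eq_bigr => i _; exact: rmorphXn.
Qed.

Lemma dilate_distinct_gf x : dilate (distinct_gf x) = distinct_gf (x * q).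
Proof.
rewrite /dilate rmorph_prod; apply: eq_bigr => k _ /=.
by rewrite rmorphD rmorph1 /= -/(dilate _) dilateZX mulrAC.
Qed.

Lemma dilate_multi_gf x : dilate (multi_gf x) = multi_gf (x * q).
Proof.
rewrite /dilate rmorph_prod; apply: eq_bigr => k _ /=.
by rewrite -/(dilate _) dilate_geo dilateZX mulrAC.
Qed.

Lemma dilate_multi2_gf x : dilate (multi2_gf x) = multi2_gf (x * q ^+ 2).
Proof.
rewrite /dilate rmorph_prod; apply: eq_bigr => k _ /=.
by rewrite -/(dilate _) dilate_geo dilateZX2 mulrAC.
Qed.

Definition base_gf (a b c d xi : R) : {poly R} :=
  distinct_gf (a * b) * distinct_gf (a * c) * distinct_gf (a * d)
  * (distinct_gf (b * c) * distinct_gf (b * d) * distinct_gf (c * d))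
  * (multi_gf a * multi_gf b * multi_gf c * multi_gf d * multi2_gf xi).

(** This is the series V. In the application [numer] accounts for the exceptional rules on the parts
    up to 15. *)
Definition four_color_gf (a b c d pa pb pc pd xi : R) : {poly R} :=
  base_gf a b c d xi
  * numer q%:P a%:P b%:P c%:P d%:P pa%:P pb%:P pc%:P pd%:P xi%:P 'X.

Lemma energy_step (a b c d pa pb pc pd xi : R) :
  a ^+ N = 0 -> b ^+ N = 0 -> c ^+ N = 0 -> d ^+ N = 0 -> xi ^+ N = 0 ->
  telescopes q%:P a%:P b%:P c%:P d%:P pa%:P pb%:P pc%:P pd%:P xi%:P 'X ->
  energy (four_color_gf a b c d pa pb pc pd xi)
  = (1 + a) * energy (four_color_gf (a * q) b c d pa (pb * q) (pc * q) (pd * q) (xi * q)).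
Proof.
move=> a0 b0 c0 d0 xi0 tele.
(* M is the common factor: the series with parameters (a, xi), the one with (a q, xi q), and the
   dilated one are each a polynomial times M. *)
pose M := distinct_gf (a * b * q) * distinct_gf (a * c * q) * distinct_gf (a * d * q)
  * (distinct_gf (b * c * q) * distinct_gf (b * d * q) * distinct_gf (c * d * q))
  * (multi_gf a * multi_gf b * multi_gf c * multi_gf d * multi2_gf xi).
have baseE : base_gf a b c d xi = pairs_prod a%:P b%:P c%:P d%:P 'X * M.
  rewrite /base_gf /M (distinct_gf_shift (a * b)) (distinct_gf_shift (a * c))
    (distinct_gf_shift (a * d)) (distinct_gf_shift (b * c))
    (distinct_gf_shift (b * d)) (distinct_gf_shift (c * d)) /pairs_prod.
  rewrite -!polyCM -!mul_polyC.
  by ring.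
have base_shift : base_gf (a * q) b c d (xi * q)
  = (1 - a%:P * 'X) * (1 - xi%:P * 'X ^+ 2) * ((1 + b%:P * c%:P * 'X)
     * (1 + b%:P * d%:P * 'X) * (1 + c%:P * d%:P * 'X)) * M.
  rewrite /base_gf /M (distinct_gf_shift (b * c)) (distinct_gf_shift (b * d)).
  rewrite (distinct_gf_shift (c * d)) -multi_gf_shift // -multi2_gf_shift //.
  rewrite !(mulrAC a q) -!polyCM -!mul_polyC; ring.
have base_dilate : dilate (base_gf a b c d xi)
  = (1 - a%:P * 'X) * (1 - b%:P * 'X) * (1 - c%:P * 'X) * (1 - d%:P * 'X)
     * ((1 - xi%:P * 'X ^+ 2) * (1 - xi%:P * q%:P * 'X ^+ 2)) * M.
  rewrite /base_gf !dilateM !dilate_distinct_gf !dilate_multi_gf dilate_multi2_gf.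
  (* Dilation sends Z^2 to q^2 Z^2, so the series in xi Z^2 shifts twice and gives two factors. *)
  rewrite -!multi_gf_shift // [q ^+ 2]expr2 [xi * _]mulrA -multi2_gf_shift; last first.
    by rewrite exprMn xi0 mul0r.
  by rewrite -multi2_gf_shift // /M -polyCM -!mul_polyC; ring.
set sg := certif a%:P b%:P c%:P d%:P pa%:P pb%:P pc%:P pd%:P xi%:P 'X.
have sg_dilate : dilate sg
  = certif a%:P b%:P c%:P d%:P pa%:P pb%:P pc%:P pd%:P xi%:P (q%:P * 'X).
  rewrite /dilate /sg /certif !(rmorphD, rmorphM, rmorphXn) /=.
  by rewrite !comp_polyC comp_polyX mul_polyC.
(* Here g = [sg * base_gf a b c d xi], and E vanishes on Z g(Z) - g(qZ). *)
have key : four_color_gf a b c d pa pb pc pd xi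
  - (1 + a) *: four_color_gf (a * q) b c d pa (pb * q) (pc * q) (pd * q) (xi * q)
  = 'X * (sg * base_gf a b c d xi) - dilate (sg * base_gf a b c d xi).
  rewrite dilateM sg_dilate base_dilate baseE.
  rewrite /four_color_gf baseE base_shift -mul_polyC !polyCM polyCD.
  move: tele; rewrite /telescopes -/sg.
  set lhs := (X in X = _ -> _); set rhs := (X in _ = X -> _) => tele.
  transitivity (lhs * M); first by rewrite /lhs; ring.
  by rewrite tele /rhs; ring.
apply/eqP; rewrite -subr_eq0 -energyZ -energyB key energyB energyXM subrr //.
Qed.

End Series.

(** The swaps bring b, c and d in turn to the first place, the only one on which the functional
    equation acts. *)
Lemma four_color_gf_swap12 (R : comNzRingType) (q : R) N a b c d pa pb pc pd xi :
  four_color_gf q N a b c d pa pb pc pd xi = four_color_gf q N b a c d pb pa pc pd xi.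
Proof. by rewrite /four_color_gf /base_gf /numer (mulrC b a); ring. Qed.

Lemma four_color_gf_swap13 (R : comNzRingType) (q : R) N a b c d pa pb pc pd xi :
  four_color_gf q N a b c d pa pb pc pd xi = four_color_gf q N c b a d pc pb pa pd xi.
Proof.
by rewrite /four_color_gf /base_gf /numer (mulrC c a) (mulrC c b) (mulrC b a); ring.
Qed.

Lemma four_color_gf_swap14 (R : comNzRingType) (q : R) N a b c d pa pb pc pd xi :
  four_color_gf q N a b c d pa pb pc pd xi = four_color_gf q N d b c a pd pb pc pa xi.
Proof.
rewrite /four_color_gf /base_gf /numer (mulrC d a) (mulrC d b) (mulrC d c).
by rewrite (mulrC b a) (mulrC c a); ring.
Qed.

(** * Iterating the functional equation and eliminating the parameters *)

Section Iteration.
Variables (D : idomainType) (R : comNzRingType) (f : {rmorphism D -> R}).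
Variables (q : D) (N : nat).
Hypotheses (q0 : q != 0) (q_nil : f q ^+ N = 0).


(** The parameters live in the domain [D], where q can be cancelled; the series lives over [R],
    where q is nilpotent. *)
Definition image_gf (a b c d pa pb pc pd xi : D) : {poly R} :=
  four_color_gf (f q) N (f a) (f b) (f c) (f d) (f pa) (f pb) (f pc) (f pd) (f xi).

Lemma energy_image_step (a b c d pa pb pc pd xi : D) :
  f a ^+ N = 0 -> f b ^+ N = 0 -> f c ^+ N = 0 -> f d ^+ N = 0 -> f xi ^+ N = 0 ->
  q * pa = b * c * d -> q * pb = a * c * d -> q * pc = a * b * d ->
  q * pd = a * b * c -> q * xi = a * pa ->
  energy (f q) (image_gf a b c d pa pb pc pd xi) = (1 + f a)
    * energy (f q) (image_gf (a * q) b c d pa (pb * q) (pc * q) (pd * q) (xi * q)).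
Proof.
move=> a0 b0 c0 d0 xi0 ea eb ec ed exi.
rewrite /image_gf energy_step // ?rmorphM //.
(* The identity holds in the polynomial domain over [D] and is mapped to [R] coefficientwise. *)
rewrite -!(map_polyC f) -[X in telescopes _ _ _ _ _ _ _ _ _ _ X](map_polyX f).
apply: telescopes_rmorph; apply: telescopes_idomain;
  by rewrite ?polyC_eq0 // -!polyCM ?ea ?eb ?ec ?ed ?exi.
Qed.

Lemma energy_image_iter j (a b c d pa pb pc pd xi : D) :
  f a ^+ N = 0 -> f b ^+ N = 0 -> f c ^+ N = 0 -> f d ^+ N = 0 -> f xi ^+ N = 0 ->
  q * pa = b * c * d -> q * pb = a * c * d -> q * pc = a * b * d ->
  q * pd = a * b * c -> q * xi = a * pa ->
  energy (f q) (image_gf a b c d pa pb pc pd xi)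
  = \prod_(k < j) (1 + f a * f q ^+ k)
    * energy (f q) (image_gf (a * q ^+ j) b c d pa (pb * q ^+ j) (pc * q ^+ j)
                             (pd * q ^+ j) (xi * q ^+ j)).
Proof.
elim: j a pb pc pd xi => [|j IHj] a pb pc pd xi a0 b0 c0 d0 xi0 ea eb ec ed exi.
  by rewrite big_ord0 mul1r !expr0 !mulr1.
rewrite energy_image_step // IHj ?rmorphM ?exprMn ?a0 ?xi0 ?mul0r //.
- rewrite big_ord_recl expr0 mulr1 mulrA; congr (_ * _ * energy _ _).
    by apply: eq_bigr => k _; rewrite exprS mulrA.
  by rewrite !exprS !mulrA.
- by rewrite mulrA eb; ring.
- by rewrite mulrA ec; ring.
- by rewrite mulrA ed; ring.
- by rewrite mulrA exi; ring.
Qed.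

(** After N steps every parameter that has gained a factor q^N is 0. Only pa = bcd/q, which does not
    involve a, survives among the auxiliary ones. *)
Lemma energy_image (a b c d pa pb pc pd xi : D) :
  f a ^+ N = 0 -> f b ^+ N = 0 -> f c ^+ N = 0 -> f d ^+ N = 0 -> f xi ^+ N = 0 ->
  q * pa = b * c * d -> q * pb = a * c * d -> q * pc = a * b * d ->
  q * pd = a * b * c -> q * xi = a * pa ->
  energy (f q) (image_gf a b c d pa pb pc pd xi)
  = \prod_(k < N) (1 + f a * f q ^+ k)
    * energy (f q) (image_gf 0 b c d pa 0 0 0 0).
Proof.
move=> a0 b0 c0 d0 xi0 ea eb ec ed exi.
rewrite (energy_image_iter N) //; congr (_ * energy _ _).
by rewrite /image_gf !rmorphM !rmorphXn q_nil !mulr0 !rmorph0.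
Qed.

Lemma four_parameter (a b c d pa pb pc pd xi : D) :
  f a ^+ N = 0 -> f b ^+ N = 0 -> f c ^+ N = 0 -> f d ^+ N = 0 -> f xi ^+ N = 0 ->
  q * pa = b * c * d -> q * pb = a * c * d -> q * pc = a * b * d ->
  q * pd = a * b * c -> q * xi = a * pa ->
  energy (f q) (image_gf a b c d pa pb pc pd xi)
  = \prod_(x <- [:: a; b; c; d]) \prod_(k < N) (1 + f x * f q ^+ k).
Proof.
move=> a0 b0 c0 d0 xi0 ea eb ec ed exi.
have z0 : f 0 ^+ N = 0 by rewrite rmorph0 expr0n gtn_eqF // (N_gt0 q_nil).
rewrite !big_cons big_nil mulr1 energy_image //; congr (_ * _).
(* The swap also moves the surviving pa to the second place, where the next round sends it to 0. *)
rewrite /image_gf four_color_gf_swap12 -/(image_gf _ _ _ _ _ _ _ _ _).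
rewrite energy_image ?mulr0 ?mul0r //; congr (_ * _).
rewrite /image_gf four_color_gf_swap13 -/(image_gf _ _ _ _ _ _ _ _ _).
rewrite energy_image ?mulr0 ?mul0r //; congr (_ * _).
rewrite /image_gf four_color_gf_swap14 -/(image_gf _ _ _ _ _ _ _ _ _).
rewrite energy_image ?mulr0 ?mul0r //.
suff -> : image_gf 0 0 0 0 0 0 0 0 0 = 'X^0 by rewrite energyXn expr0 mulr1.
have d1 : distinct_gf (f q) N 0 = 1.
  by apply: big1 => k _; rewrite mul0r scale0r addr0.
have m1 : multi_gf (f q) N 0 = 1.
  by apply: big1 => k _; rewrite mul0r scale0r geo0 // (N_gt0 q_nil).
have m2 : multi2_gf (f q) N 0 = 1.
  by apply: big1 => k _; rewrite mul0r scale0r geo0 // (N_gt0 q_nil).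
rewrite /image_gf rmorph0 /four_color_gf /base_gf !mul0r d1 m1 m2 /numer polyC0.
by rewrite expr0; ring.
Qed.

End Iteration.

(** * Generating functions modulo a power of x *)

Section Truncation.
Variable n : nat.
Let N := n.+1.
Let R := {poly %/ ('X^N : {poly int})}.
Let f : {rmorphism {poly int} -> R} := in_qpoly ('X^N : {poly int}).

Lemma truncE p : f p = take_poly N p :> {poly int}.
Proof. by rewrite /= mk_monic_Xn Pdiv.RingMonic.take_poly_rmodp. Qed.

Lemma trunc_Xn m : (n < m)%N -> f 'X ^+ m = 0.
Proof.
move=> nm; rewrite -rmorphXn; apply/val_inj/polyP => i.
rewrite [val _]truncE coef_take_poly coefXn coef0; case: ltnP => // lt_iN.
by rewrite ltn_eqF // (leq_ltn_trans _ nm).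
Qed.

(** The coefficient of x^n survives reduction modulo x^(n+1) and counts the entries of sum n. *)
Lemma trunc_count (E E' : seq (seq nat)) :
  \sum_(s <- E) f 'X ^+ sumn s = \sum_(s <- E') f 'X ^+ sumn s ->
  count (fun s => sumn s == n) E = count (fun s => sumn s == n) E'.
Proof.
have coefE (F : seq (seq nat)) :
    (val (\sum_(s <- F) f 'X ^+ sumn s))`_n = (count (fun s => sumn s == n) F)%:Z.
  rewrite (eq_bigr (fun s => f 'X^(sumn s))); last by move=> s _; rewrite rmorphXn.
  rewrite -rmorph_sum [val _]truncE coef_take_poly ltnSn coef_sum.
  rewrite -sum1_count -[RHS]natz natr_sum [RHS]big_mkcond.
  by apply: eq_bigr => s _; rewrite coefXn eq_sym; case: eqP.
by move/(congr1 (fun g : R => (val g)`_n)); rewrite !coefE => -[].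
Qed.

Let x : R := f 'X.
Let q : R := f 'X^15.
Let v := (15 * N)%N.
Let w (u : nat) : {poly R} := x ^+ u *: 'X^(weight15 u).

Lemma prod_w (c : seq nat) :
  \prod_(u <- c) w u = x ^+ sumn c *: 'X^(sumn (map weight15 c)).
Proof.
elim: c => [|u c IHc]; first by rewrite big_nil expr0 scale1r.
by rewrite big_cons IHc /w /= !exprD -scalerAr -scalerAl scalerA mulrC.
Qed.

(** By [sumn_stack], stacking a configuration of weight m multiplies its monomial by q^binom(m, 2),
    which is the effect of E on Z^m. *)
Lemma energy_confs :
  \sum_(s <- map stack (confs N v)) x ^+ sumn s
  = energy q (\sum_(c <- confs N v) \prod_(u <- c) w u).
Proof.
rewrite energy_sum big_map; apply: eq_bigr => c _.
by rewrite sumn_stack exprD exprM prod_w energyZ energyXn /q rmorphXn.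
Qed.

Let local_gf (ms : nat -> nat -> seq nat) u : {poly R} := \sum_(i <- ms N u) w u ^+ i.

Lemma confs_gf : \sum_(c <- confs N v) \prod_(u <- c) w u
  = \prod_(k < N) \prod_(r < 15) local_gf mult_no7_no11 (15 * k + r.+1)
  + \prod_(k < N) \prod_(r < 15) local_gf mult_no7_11 (15 * k + r.+1)
  + \prod_(k < N) \prod_(r < 15) local_gf mult_7 (15 * k + r.+1).
Proof.
rewrite /confs !big_cat -[RHS]addrA -!prod_by15.
by congr (_ + (_ + _)); apply: mult_lists_gf.
Qed.

Let high k := \prod_(r < 15) local_gf mult_large (15 * k + r.+1).

(** All three cases share the rules for parts above 15, so these parts form a common factor. *)
Lemma split_low ms : (forall u, (15 < u)%N -> ms N u = mult_large N u) ->
  \prod_(k < N) \prod_(r < 15) local_gf ms (15 * k + r.+1)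
  = \prod_(r < 15) local_gf ms r.+1 * \prod_(k < n) high k.+1.
Proof.
move=> msE; rewrite /N big_ord_recl; congr (_ * _).
apply: eq_bigr => k _; apply: eq_bigr => r _; rewrite /local_gf msE //.
rewrite lift0; lia.
Qed.

Lemma sum_iota0 (p : {poly R}) : \sum_(i <- iota 0 N) p ^+ i = geo N p.
Proof. by rewrite /geo -[N in iota 0 N]subn0 -/(index_iota 0 N) big_mkord. Qed.

Lemma sum_iota1 (p : {poly R}) : \sum_(i <- iota 1 N.-1) p ^+ i = geo N p - 1.
Proof. by rewrite -sum_iota0 /N /= big_cons expr0 addrC addKr. Qed.

Lemma sum_01 (p : {poly R}) : \sum_(i <- [:: 0; 1]%N) p ^+ i = 1 + p.
Proof. by rewrite !big_cons big_nil addr0. Qed.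

Lemma sum_0 (p : {poly R}) : \sum_(i <- [:: 0%N]) p ^+ i = 1.
Proof. by rewrite big_seq1. Qed.

Lemma highE k : high k.+1 =
  (1 + w (15 * k + 18)) * (1 + w (15 * k + 20)) * (1 + w (15 * k + 21))
  * ((1 + w (15 * k + 24)) * (1 + w (15 * k + 25)) * (1 + w (15 * k + 27)))
  * (geo N (w (15 * k + 22)) * geo N (w (15 * k + 26)) * geo N (w (15 * k + 28))
     * geo N (w (15 * k + 29)) * geo N (w (15 * k + 30))).
Proof.
have largeE r : mult_large N (15 * k.+1 + r)%N = mult_large N r.
  by rewrite /mult_large addnC dvdn15_shift pow2_mod15_shift negpow2_mod15_shift.
rewrite /high !big_ord_recr big_ord0 /= /local_gf !largeE /mult_large /=.
rewrite !sum_0 !sum_01 !sum_iota0 !mulr1 !mul1r !mulnSr -!addnA /=.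
by ring.
Qed.

Lemma qX k m : x ^+ m * q ^+ k = x ^+ (15 * k + m).
Proof. by rewrite /q rmorphXn -exprM -exprD addnC. Qed.

Lemma weight15_shift k m : weight15 (15 * k + m) = weight15 m.
Proof. by rewrite /weight15 addnC dvdn15_shift. Qed.

Lemma distinct_gf_w m : (0 < m)%N -> weight15 m = 1%N ->
  distinct_gf q N (x ^+ m) = \prod_(k < n) (1 + w (15 * k + m)).
Proof.
move=> m0 wm; rewrite /distinct_gf /N big_ord_recr /= qX.
(* The factor k = n is trivial because x^(15 n + m) = 0 in the quotient. *)
rewrite (@trunc_Xn (15 * n + m)); last by lia.
rewrite scale0r addr0 mulr1; apply: eq_bigr => k _.
by rewrite qX /w weight15_shift wm.
Qed.

Lemma multi_gf_w m : weight15 m = 1%N ->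
  multi_gf q N (x ^+ m) = geo N (w m) * \prod_(k < n) geo N (w (15 * k + (m + 15))).
Proof.
move=> wm; rewrite /multi_gf {2}/N big_ord_recl expr0 mulr1 /w wm; congr (_ * _).
apply: eq_bigr => k _; rewrite qX weight15_shift lift0.
have -> : weight15 (m + 15) = 1%N by rewrite addnC (weight15_shift 1).
by rewrite (_ : (15 * k.+1 + m = 15 * k + (m + 15))%N) //; lia.
Qed.

Lemma multi2_gf_w m : weight15 m = 2%N ->
  multi2_gf q N (x ^+ m) = geo N (w m) * \prod_(k < n) geo N (w (15 * k + (m + 15))).
Proof.
move=> wm; rewrite /multi2_gf {2}/N big_ord_recl expr0 mulr1 /w wm; congr (_ * _).
apply: eq_bigr => k _; rewrite qX weight15_shift lift0.
have -> : weight15 (m + 15) = 2%N by rewrite addnC (weight15_shift 1).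
by rewrite (_ : (15 * k.+1 + m = 15 * k + (m + 15))%N) //; lia.
Qed.

(** The first secondary parts above 15 are the pairwise sums 18, 20, 21, 24, 25, 27 of 7, 11, 13,
    14, so the series in ab, ..., cd produce them. The k = 0 factors of the other series give the
    parts 7, 11, 13, 14, 15. *)
Lemma base_gf_high :
  base_gf q N (x ^+ 7) (x ^+ 11) (x ^+ 13) (x ^+ 14) (x ^+ 15)
  = geo N (w 7) * geo N (w 11) * geo N (w 13) * geo N (w 14) * geo N (w 15)
    * \prod_(k < n) high k.+1.
Proof.
rewrite (eq_bigr _ (fun (k : 'I_n) _ => highE k)) !big_split /=.
rewrite /base_gf -!exprD !distinct_gf_w // !multi_gf_w // multi2_gf_w //=.
by ring.
Qed.

Lemma polyC_exp (y : R) m : (y ^+ m)%:P = y%:P ^+ m.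
Proof. exact: rmorphXn. Qed.

Lemma wE u : w u = x%:P ^+ u * 'X ^+ weight15 u.
Proof. by rewrite /w -mul_polyC polyC_exp. Qed.

Lemma geo_w u : (0 < u)%N -> (1 - w u) * geo N (w u) = 1.
Proof.
move=> u0; rewrite geo_inv // /w exprZn -exprM.
by rewrite (@trunc_Xn (u * N)) ?scale0r // leq_pmull.
Qed.

Lemma geo_w1 u : (0 < u)%N -> geo N (w u) - 1 = w u * geo N (w u).
Proof. by move=> u0; rewrite -[X in _ - X](geo_w u0); ring. Qed.

(** The exponents 23, 19, 17, 16 are sums of three of 7, 11, 13, 14 less 15, and the 15 for xi is
    the sum of all four less 30. *)
Lemma low_gf :
  \prod_(r < 15) local_gf mult_no7_no11 r.+1
  + \prod_(r < 15) local_gf mult_no7_11 r.+1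
  + \prod_(r < 15) local_gf mult_7 r.+1
  = geo N (w 7) * geo N (w 11) * geo N (w 13) * geo N (w 14) * geo N (w 15)
    * numer q%:P (x ^+ 7)%:P (x ^+ 11)%:P (x ^+ 13)%:P (x ^+ 14)%:P
        (x ^+ 23)%:P (x ^+ 19)%:P (x ^+ 17)%:P (x ^+ 16)%:P (x ^+ 15)%:P 'X.
Proof.
have g7 := @geo_w 7 isT; have g11 := @geo_w 11 isT; have g15 := @geo_w 15 isT.
(* Factors (1 - w u) * geo N (w u) = 1 are inserted so that each case contains all five geometric
   series, which then act as variables in a polynomial identity. *)
have e0 : \prod_(r < 15) local_gf mult_no7_no11 r.+1
    = geo N (w 13) * geo N (w 14) * ((1 - w 7) * geo N (w 7))
      * ((1 - w 11) * geo N (w 11)) * ((1 - w 15) * geo N (w 15)).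
  rewrite g7 g11 g15 !mulr1 !big_ord_recr big_ord0 /= /local_gf /mult_no7_no11 /=.
  by rewrite !sum_0 !sum_iota0 !mulr1 !mul1r.
have e1 : \prod_(r < 15) local_gf mult_no7_11 r.+1
    = w 11 * geo N (w 11) * (1 + w 12) * geo N (w 13) * geo N (w 14)
      * ((1 - w 7) * geo N (w 7)) * ((1 - w 15) * geo N (w 15)).
  rewrite g7 g15 !mulr1 !big_ord_recr big_ord0 /= /local_gf /mult_no7_11 /=.
  by rewrite !sum_0 !sum_01 !sum_iota0 (sum_iota1 (w 11)) !mulr1 !mul1r geo_w1.
have e2 : \prod_(r < 15) local_gf mult_7 r.+1
    = w 7 * geo N (w 7) * (1 + w 9) * (1 + w 10) * (1 + w 12)
      * geo N (w 11) * geo N (w 13) * geo N (w 14) * geo N (w 15).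
  rewrite !big_ord_recr big_ord0 /= /local_gf /mult_7 /=.
  rewrite !sum_0 !sum_01 !sum_iota0 (sum_iota1 (w 7)) !mulr1 !mul1r geo_w1 //.
  by ring.
rewrite e0 e1 e2 /numer {g7 g11 g15 e0 e1 e2}.
move: (geo N (w 7)) (geo N (w 11)) (geo N (w 13)) (geo N (w 14)) (geo N (w 15)).
move=> g7 g11 g13 g14 g15; have -> : q = x ^+ 15 by rewrite /q rmorphXn.
rewrite !wE /weight15 /= !polyC_exp.
by ring.
Qed.

Lemma confs_four_color : \sum_(c <- confs N v) \prod_(u <- c) w u
  = four_color_gf q N (x ^+ 7) (x ^+ 11) (x ^+ 13) (x ^+ 14)
      (x ^+ 23) (x ^+ 19) (x ^+ 17) (x ^+ 16) (x ^+ 15).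
Proof.
rewrite confs_gf !split_low;
  try by move=> u u15; rewrite /mult_no7_no11 /mult_no7_11 /mult_7 u15.
rewrite -!mulrDl low_gf /four_color_gf base_gf_high; ring.
Qed.

Lemma P3_gf : \sum_(s <- mult_lists mult_P3 v) x ^+ sumn s
  = \prod_(y <- [:: x ^+ 7; x ^+ 11; x ^+ 13; x ^+ 14]) \prod_(k < N) (1 + y * q ^+ k).
Proof.
rewrite (eq_bigr (fun s => \prod_(u <- s) x ^+ u)); last first.
  by move=> s _; elim: s => [|u s /= IHs]; rewrite ?big_nil ?big_cons // exprD IHs.
rewrite mult_lists_gf prod_by15 !big_cons big_nil mulr1 -!big_split /=.
apply: eq_bigr => k _; rewrite !big_ord_recr big_ord0 /=.
have P3E r : mult_P3 (15 * k + r)%N = mult_P3 r.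
  by rewrite /mult_P3 addnC negpow2_mod15_shift.
rewrite !P3E /mult_P3 /= !big_cons !big_nil !addr0 !mulr1 !mul1r !qX.
by rewrite expr1; ring.
Qed.

Lemma energy_confs_P3 : energy q (\sum_(c <- confs N v) \prod_(u <- c) w u)
  = \sum_(s <- mult_lists mult_P3 v) x ^+ sumn s.
Proof.
have nil m : (0 < m)%N -> f 'X^m ^+ N = 0.
  by move=> m0; rewrite rmorphXn -exprM (@trunc_Xn (m * N)) // leq_pmull.
rewrite confs_four_color P3_gf.
have -> : four_color_gf q N (x ^+ 7) (x ^+ 11) (x ^+ 13) (x ^+ 14)
      (x ^+ 23) (x ^+ 19) (x ^+ 17) (x ^+ 16) (x ^+ 15)
    = image_gf f 'X^15 N 'X^7 'X^11 'X^13 'X^14 'X^23 'X^19 'X^17 'X^16 'X^15.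
  by rewrite /image_gf [f 'X^7]rmorphXn [f 'X^11]rmorphXn [f 'X^13]rmorphXn
    [f 'X^14]rmorphXn [f 'X^23]rmorphXn [f 'X^19]rmorphXn [f 'X^17]rmorphXn
    [f 'X^16]rmorphXn /q [f 'X^15]rmorphXn.
rewrite /q four_parameter ?nil // -?exprD //.
- by rewrite !big_cons !big_nil [f 'X^7]rmorphXn [f 'X^11]rmorphXn [f 'X^13]rmorphXn
    [f 'X^14]rmorphXn.
- by rewrite monic_neq0 ?monicXn.
Qed.
End Truncation.

Theorem theorem3 (n : nat) : G3 n = P3 n.
Proof.
have nv : (n <= 15 * n.+1)%N by lia.
rewrite (@G3_count n (15 * n.+1)) // ?(@P3_count n (15 * n.+1)) //; last by lia.
by apply: trunc_count; rewrite energy_confs energy_confs_P3.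
Qed.
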